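(* Let $G$ be a Gurariy space and let $X$ be a Banach space that is almost isometric to $G$. Then $X$ is also a Gurariy space.
   Context: Let $X, Y$ be Banach spaces and $\varepsilon>0$. A linear operator $T: X\to Y$ is an $\varepsilon$-isometry if $(1+\varepsilon)^{-1}\|x\|\le \|T(x)\|\le (1+\varepsilon)\|x\|$ for all $x\in X$. $X$ and $Y$ are almost isometric if for every $\varepsilon>0$ there is an onto $\varepsilon$-isometry $T:X\to Y$. A Banach space $X$ is a Gurariy space if for every $\varepsilon>0$ and every pair of finite dimensional normed spaces $E\subseteq F$, every linear isometry (into) $T:E\to X$ extends to an $\varepsilon$-isometry $\widetilde{T}:F\to X$. No separability is assumed. *)

(* Defs.v *)
From HB Require Import structures.
From mathcomp Require Import all_boot all_order all_algebra.
From mathcomp Require Import complex.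
From mathcomp Require Import all_classical all_reals all_analysis.

Set Implicit Arguments.
Unset Strict Implicit.
Unset Printing Implicit Defensive.

Import Order.TTheory GRing.Theory Num.Theory.
Import numFieldNormedType.Exports.

Local Open Scope ring_scope.

#[short(type="normedVectType")]
HB.structure Definition NormedVector (K : numFieldType) :=
  {V of Vector K V & NormedModule K V}.

Definition eps_isometry (K : numFieldType) (X Y : normedModType K)
    (eps : K) (T : {linear X -> Y}) : Prop :=
  forall x : X, (1 + eps)^-1 * `|x| <= `|T x| <= (1 + eps) * `|x|.

Definition almost_isometric (K : numFieldType)
    (X Y : completeNormedModType K) : Prop :=
  forall eps : K, 0 < eps ->
    exists T : {linear X -> Y},
      eps_isometry eps T /\ (forall y : Y, exists x : X, T x = y).

(* Over K = R[i], 0 < eps means that eps is a positive real.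
   The subspace E of F carries the norm inherited from F, so an element x of
   E has norm `|vsval x|; subvs_of E itself has no normed structure. *)
Definition gurariy (K : numFieldType) (X : completeNormedModType K) : Prop :=
  forall eps : K, 0 < eps ->
  forall (F : normedVectType K) (E : {vspace F}) (T : {linear subvs_of E -> X}),
    (forall x : subvs_of E, `|T x| = `|vsval x|) ->
    exists T' : {linear F -> X},
      eps_isometry eps T' /\ (forall x : subvs_of E, T' (vsval x) = T x).

(* Main.v *)
(** Let [S : X -> G] be an onto [d]-isometry and [T : E -> X] an isometry. The
    norm [`|S (T e)|] on [E] extends to a norm on [F] that is
    [(1 + d)]-equivalent to the original one. For this new norm, [S \o T] is
    an isometry, so it extends to a [d]-isometry [U] from [F] to [G], and
    [S^-1 \o U] extends [T] with constant [(1 + d) ^+ 3]. *)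

Require Import Defs.
From HB Require Import structures.
From mathcomp Require Import all_boot all_order all_algebra.
From mathcomp Require Import complex.
From mathcomp Require Import all_classical all_reals all_analysis.
From mathcomp Require Import ring.
Import numFieldNormedType.Exports.

Local Open Scope ring_scope.
Local Open Scope complex_scope.

Import Order.TTheory GRing.Theory Num.Theory.

(* The form of order completeness of the reals that also holds in [R[i]], whose
   order is partial: it allows one proof for both scalar fields. *)
Definition has_nneg_infima (K : numFieldType) : Prop :=
  forall A : set K, (A !=set0)%classic -> (forall a, A a -> 0 <= a) ->
    exists m : K, (forall a, A a -> m <= a) /\
      (forall l, (forall a, A a -> l <= a) -> l <= m).

Lemma real_has_nneg_infima (R : realType) : has_nneg_infima R.
Proof.
move=> A A0 Age0; exists (inf A); split=> [a Aa|l lA].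
  by apply: ge_inf => //; exists 0.
exact: lb_le_inf.
Qed.

(** Nonnegative elements of [R[i]] are real, so the infimum can be computed among real parts. *)
Lemma complex_has_nneg_infima (R : realType) : has_nneg_infima R[i].
Proof.
move=> A [a0 Aa0] Age0.
have [|r /Age0|m [mA Am]] := @real_has_nneg_infima R [set r : R | A r%:C]%classic.
- by exists (complex.Re a0) => /=; rewrite RRe_real// ger0_real// Age0.
- by rewrite lecR.
exists m%:C; split=> [a Aa|l lA].
  have aE : (complex.Re a)%:C = a by rewrite RRe_real// ger0_real// Age0.
  by rewrite -aE lecR; apply: mA => /=; rewrite aE.
(* Comparability with the real number [a0] forces the lower bound [l] to be real. *)
have := lA _ Aa0; rewrite lecE (ger0_Im (Age0 _ Aa0)) eq_sym => /andP[l0 _].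
rewrite lecE /= eq_sym l0 /=; apply: Am => r /= Ar.
by have := lA _ Ar; rewrite lecE /= => /andP[].
Qed.

Record vnorm (K : numFieldType) (F : vectType K) := Vnorm {
  vnorm_fun :> F -> K;
  vnormD : forall x y, vnorm_fun (x + y) <= vnorm_fun x + vnorm_fun y;
  vnormZ : forall a x, vnorm_fun (a *: x) = `|a| * vnorm_fun x;
  vnorm_eq0 : forall x, vnorm_fun x = 0 -> x = 0
}.

(** An alias convertible to [F]: it carries the norm [N] without clashing with the norm of [F],
    while subspaces and maps of [F] are reused unchanged. *)
Definition renormed (K : numFieldType) (F : vectType K) (N : vnorm K F) : Type :=
  F.

HB.instance Definition _ (K : numFieldType) (F : vectType K) (N : vnorm K F) :=
  Vector.on (renormed K F N).

HB.instance Definition _ (K : numFieldType) (F : vectType K) (N : vnorm K F) :=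
  Lmodule_isNormed.Build K (renormed K F N)
    (vnormD _ _ N) (vnormZ _ _ N) (vnorm_eq0 _ _ N).

(* The largest norm which is at most [c * `|x|] on [F] and at most [`|T e|]
   on [E], that is [inf_e (`|T e| + c * `|x - e|)]. *)
Lemma extend_equivalent_norm (K : numFieldType) (infK : has_nneg_infima K)
    (F : normedVectType K) (E : {vspace F}) (G : normedModType K) (c : K)
    (T : {linear subvs_of E -> G}) :
  1 <= c ->
  (forall x, c^-1 * `|vsval x| <= `|T x| <= c * `|vsval x|) ->
  exists N : vnorm K F, (forall x, N (vsval x) = `|T x|) /\
    (forall x, c^-1 * `|x| <= N x <= c * `|x|).
Proof.
move=> c1 Tc.
have c0 : 0 < c by apply: lt_le_trans c1.
pose p (x : F) (e : subvs_of E) : K := `|T e| + c * `|x - vsval e|.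
have p0 x e : 0 <= p x e by rewrite addr_ge0// mulr_ge0// ltW.
have pD x y e e' : p (x + y) (e + e') <= p x e + p y e'.
  rewrite /p [leRHS]addrACA !linearD /= [x + y + _]addrACA lerD ?ler_normD//.
  by rewrite -mulrDr ler_wpM2l ?ler_normD// ltW.
have pZ a x e : p (a *: x) (a *: e) = `|a| * p x e.
  by rewrite /p !linearZ /= -scalerDr !normrZ mulrDr mulrCA.
have : forall x, exists m : K, (forall e, m <= p x e) /\
    (forall l, (forall e, l <= p x e) -> l <= m).
  move=> x; have [|_ [e _ <-]//|m [mp pm]] := infK (range (p x)).
    by exists (p x 0), 0.
  exists m; split=> [e|l lp]; first by apply: mp; exists e.
  by apply: pm => _ [e _ <-].
move=> /choice[N /all_and2[Np pN]].
have ND x y : N (x + y) <= N x + N y.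
  rewrite -lerBlDr; apply: (pN x) => e; rewrite lerBlDr -lerBlDl.
  by apply: (pN y) => e'; rewrite lerBlDl; apply: le_trans (pD _ _ _ _).
(* Only one inequality is proved here; the converse follows by applying it to [a^-1] and
   [a *: x]. *)
have NZ_le a x : a != 0 -> N (a *: x) <= `|a| * N x.
  move=> a0; rewrite -ler_pdivrMl ?normr_gt0//; apply: pN => e.
  by rewrite ler_pdivrMl ?normr_gt0// -pZ.
have N_ge x : c^-1 * `|x| <= N x.
  (* Split [x] as [e + (x - e)]; since [c^-1 <= c], both terms are controlled by those of
     [p x e]. *)
  apply: pN => e; rewrite -[in `|x|](subrKC (vsval e) x).
  apply: (@le_trans _ _ (c^-1 * `|vsval e| + c * `|x - vsval e|)).
    apply: le_trans (ler_wpM2l _ (ler_normD _ _)) _; first by rewrite invr_ge0 ltW.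
    rewrite mulrDr lerD2l ler_wpM2r//.
    by apply: le_trans (c1); rewrite invf_le1.
  by rewrite lerD2r; have /andP[] := Tc e.
have N_le x : N x <= c * `|x|.
  by apply: le_trans (Np x 0) _; rewrite /p !linear0 normr0 add0r addr0.
have NZ a x : N (a *: x) = `|a| * N x.
  have [->|a0] := eqVneq a 0.
    rewrite scale0r normr0 mul0r; apply: le_anti.
    by have := N_ge 0; have := N_le 0; rewrite normr0 !mulr0 => -> ->.
  apply: le_anti; rewrite NZ_le//=.
  have := NZ_le a^-1 (a *: x); rewrite invr_eq0 scalerK// normfV => /(_ a0).
  by rewrite ler_pdivlMl// normr_gt0.
have N0 x : N x = 0 -> x = 0.
  move=> Nx; have := N_ge x; rewrite Nx pmulr_rle0 ?invr_gt0//.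
  by rewrite normr_le0 => /eqP.
exists (Vnorm K F N ND NZ N0); split=> x /=; last by rewrite N_ge N_le.
(* The choice [e = x] gives one bound. The other is the triangle inequality in [G] together with the
   upper bound on [T (x - e)]. *)
apply: le_anti; apply/andP; split.
  by apply: le_trans (Np _ x) _; rewrite /p subrr normr0 mulr0 addr0.
apply: pN => e; rewrite -[in leLHS](subrKC e x) linearD.
apply: le_trans (ler_normD _ _) _; rewrite lerD2l -linearB.
by have /andP[] := Tc (x - e).
Qed.

(** The lower bound makes [S] injective, so any chosen right inverse is linear; the two bounds swap
    roles under inversion. *)
Lemma eps_isometry_inverse (K : numFieldType) (X Y : normedModType K) (eps : K)
    (S : {linear X -> Y}) :
  0 < eps -> eps_isometry eps S -> (forall y, exists x, S x = y) ->
  exists S' : {linear Y -> X}, cancel S S' /\ eps_isometry eps S'.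
Proof.
move=> eps0 epsS /choice[g gK].
have c0 : 0 < 1 + eps by rewrite addr_gt0.
have S_inj : injective S.
  move=> x y /eqP; rewrite -subr_eq0 -linearB => /eqP Sxy.
  have /andP[+ _] := epsS (x - y).
  by rewrite Sxy normr0 pmulr_rle0 ?invr_gt0// normr_le0 subr_eq0 => /eqP.
have g_linear : linear g.
  by move=> a u v; apply: S_inj; rewrite linearP !gK.
pose gL := GRing.isLinear.Build _ _ _ _ g g_linear.
pose S' : {linear Y -> X} := HB.pack g gL.
exists S'; split=> [x|y]; first by apply: S_inj; rewrite gK.
have /andP[] := epsS (g y); rewrite gK /= => lo hi.
by rewrite ler_pdivrMl// hi -ler_pdivrMl.
Qed.

Lemma exists_cube_le1D (K : numFieldType) (eps : K) : 0 < eps ->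
  exists2 d : K, 0 < d & (1 + d) ^+ 3 <= 1 + eps.
Proof.
move=> eps0; have e7 : 0 < eps + 7 by rewrite addr_gt0.
(* This [d] satisfies [d <= 1] and [7 * d <= eps]; the cube is [1 + 3 * d + 3 * d ^+ 2 + d ^+ 3], at
   most [1 + 7 * d]. *)
exists (eps / (eps + 7)); first by rewrite divr_gt0.
set d := _ / _.
have d0 : 0 <= d by rewrite divr_ge0// ltW.
have d1 : d <= 1 by rewrite ler_pdivrMr// mul1r lerDl.
have d7 : d * 7 <= eps.
  by rewrite mulrAC ler_pdivrMr// ler_wpM2l ?(ltW eps0)// lerDr ltW.
have dd : d * d <= d by rewrite ler_piMr.
have ddd : d * d * d <= d by rewrite (le_trans _ dd)// ler_piMr// mulr_ge0.
have -> : (1 + d) ^+ 3 = 1 + (d * 3 + d * d * 3 + d * d * d) by ring.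
rewrite lerD2l (le_trans _ d7)//.
have -> : d * 7 = d * 3 + d * 3 + d by ring.
by rewrite lerD// lerD// ler_wpM2r.
Qed.

Lemma gurariy_almost_isometric (K : numFieldType) (infK : has_nneg_infima K)
    (G X : completeNormedModType K) :
  gurariy G -> almost_isometric X G -> gurariy X.
Proof.
move=> GG XG eps eps0 F E T Tiso.
have [d d0 d_eps] := exists_cube_le1D K eps eps0.
have c0 : 0 < 1 + d by rewrite addr_gt0.
have [S [Siso Sonto]] := XG d d0.
have [S' [SK S'iso]] := eps_isometry_inverse _ _ _ _ _ d0 Siso Sonto.
have [||N [NE Nc]] :=
    extend_equivalent_norm K infK F E G (1 + d) (S \o T).
- by rewrite lerDl ltW.
- by move=> x; rewrite -Tiso; exact: Siso.
have [U [Uiso UE]] := GG d d0 (renormed K F N) E (S \o T) (fun x => esym (NE x)).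
have step (x y z : K) n : x <= (1 + d) ^+ n * y -> y <= (1 + d) * z ->
    x <= (1 + d) ^+ n.+1 * z.
  move=> xy yz; apply: le_trans xy _.
  by rewrite exprSr -mulrA ler_pM2l ?exprn_gt0.
have lo x y : ((1 + d)^-1 * x <= y) = (x <= (1 + d) * y).
  by rewrite ler_pdivrMl.
(* The map [U], linear on the renormed space, is reread as a map on [F]. *)
pose V : {linear F -> X} := S' \o (U : {linear F -> G}).
exists V; split=> [x|x]; last by rewrite /= UE /= SK.
have /andP[Nlo Nhi] := Nc x; have /andP[Ulo Uhi] := Uiso x.
have /andP[Vlo Vhi] := S'iso (U x).
(* Lower bounds become upper bounds on the smaller side, so both estimates chain three factors
   [1 + d]: from [N], [U] and [S']. *)
rewrite !lo in Nlo Ulo Vlo.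
have e0 : 0 < 1 + eps by rewrite addr_gt0.
rewrite ler_pdivrMl//; apply/andP; split.
  apply: le_trans (ler_wpM2r _ d_eps) => //.
  by apply: (step _ _ _ _ _ Vlo); apply: (step _ _ _ _ _ Ulo); rewrite expr1.
apply: le_trans (ler_wpM2r _ d_eps) => //.
by apply: (step _ _ _ _ _ Nhi); apply: (step _ _ _ _ _ Uhi); rewrite expr1.
Qed.

Theorem theorem2p2 (R : realType) :
  (forall G X : completeNormedModType R,
     gurariy G -> almost_isometric X G -> gurariy X) /\
  (forall G X : completeNormedModType R[i],
     gurariy G -> almost_isometric X G -> gurariy X).
Proof.
split=> G X; apply: gurariy_almost_isometric.
  exact: real_has_nneg_infima.
exact: complex_has_nneg_infima.
Qed.
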